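(* Let $\alpha\ge 3$ be finite and let $\mathfrak{A}=\langle A,+,-,\mathsf{c}_i,\mathsf{s}_{ij},\mathsf{p}_{ij}\rangle_{i,j<\alpha}$ be an algebra with $+$ binary and $-,\mathsf{c}_i,\mathsf{s}_{ij},\mathsf{p}_{ij}$ unary. Then $\mathfrak{A}\in\mathsf{RFPA}_{\alpha}$ if and only if $\langle A,+,-,\mathsf{c}_{i},\mathsf{s}_{ij}\rangle_{i,j<\alpha}\in\mathbf{S}\mathrm{Rd}_{cs}\mathsf{RFPA}_{\alpha}$ and the following equations hold in $\mathfrak{A}$ for all distinct $i,j,k<\alpha$: \begin{align*} &\mathsf{p}_{ij}(x+y)=\mathsf{p}_{ij}(x)+\mathsf{p}_{ij}(y),\qquad \mathsf{p}_{ij}(-x)=-\mathsf{p}_{ij}(x),\\ &\mathsf{p}_{ij}\mathsf{p}_{ij}x=x,\qquad \mathsf{p}_{ij}x=\mathsf{p}_{ji}x,\qquad \mathsf{p}_{ii}x=x,\\ &\mathsf{p}_{ij}\mathsf{s}_{ji}x=\mathsf{s}_{ij}x,\\ &\mathsf{p}_{ij}\mathsf{p}_{ik}x=\mathsf{p}_{jk}\mathsf{p}_{ij}x. \end{align*}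
   Context: The ordinal $\alpha$ is identified with $\{0,\dots,\alpha-1\}$; ${}^{\alpha}U$ is the set of functions $s:\alpha\to U$; $s(i/u)$ is the sequence obtained from $s$ by replacing its $i$th value with $u$; $\mathrm{Sb}(X)$ is the power set of $X$; $\setminus$ in set algebras denotes complementation relative to the top element. For a set $U$, $R\subseteq{}^{\alpha}U$ and $i,j<\alpha$: $\mathsf{C}_i^U(R)=\{s\in{}^{\alpha}U: s(i/u)\in R\text{ for some }u\in U\}$, $\mathsf{S}_{ij}^U(R)=\{s\in{}^{\alpha}U: s(i/s(j))\in R\}$, $\mathsf{P}_{ij}^U(R)=\{s\in{}^{\alpha}U: s(i/s(j))(j/s(i))\in R\}$. $\mathsf{RFPA}_\alpha$ (representable finitary polyadic algebras) is the class of all algebras isomorphic to a subalgebra of a direct product of algebras $\langle\mathrm{Sb}({}^{\alpha}U),\cup,\setminus,\mathsf{C}_i^U,\mathsf{S}_{ij}^U,\mathsf{P}_{ij}^U\rangle_{i,j<\alpha}$, $U$ a set. $\mathbf{S}\mathrm{Rd}_{cs}\mathsf{RFPA}_\alpha$ is the class of all subalgebras of the reducts of members of $\mathsf{RFPA}_\alpha$ obtained by discarding the operations $\mathsf{p}_{ij}$, keeping the Boolean operations, $\mathsf{c}_i$ and $\mathsf{s}_{ij}$. *)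

(* Defs.v *)
From mathcomp Require Import all_boot.
From mathcomp Require Import boolp classical_sets.

Set Implicit Arguments.
Unset Strict Implicit.
Unset Printing Implicit Defensive.

Local Open Scope classical_set_scope.

(* Algebras with one binary operation [alg_add], one unary operation [alg_neg], and a
   further unary operation [alg_op o] for each symbol [o : O]. *)
Record algebra (O : Type) := Algebra {
  carrier :> Type;
  carrier_inhabited : inhabited carrier;
  alg_add : carrier -> carrier -> carrier;
  alg_neg : carrier -> carrier;
  alg_op : O -> carrier -> carrier
}.
Arguments alg_add {O a} _ _.
Arguments alg_neg {O a} _.
Arguments alg_op {O a} _ _.

Definition is_hom (O : Type) (A B : algebra O) (f : A -> B) : Prop :=
  [/\ forall x y, f (alg_add x y) = alg_add (f x) (f y),
      forall x, f (alg_neg x) = alg_neg (f x)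
    & forall o x, f (alg_op o x) = alg_op o (f x)].

Definition isomorphic (O : Type) (A B : algebra O) : Prop :=
  exists2 f : A -> B, is_hom f & bijective f.

Record subuniverse (O : Type) (A : algebra O) := Subuniverse {
  sub_set : set A;
  sub_nonempty : exists x, sub_set x;
  sub_add : forall x y, sub_set x -> sub_set y -> sub_set (alg_add x y);
  sub_neg : forall x, sub_set x -> sub_set (alg_neg x);
  sub_op : forall o x, sub_set x -> sub_set (alg_op o x)
}.

Lemma subalgebra_inhabited (O : Type) (A : algebra O) (S : subuniverse A) :
  inhabited {x : A | sub_set S x}.
Proof. by have [x Sx] := sub_nonempty S; exists; exists x. Qed.

Definition subalgebra (O : Type) (A : algebra O) (S : subuniverse A) :
    algebra O :=
  @Algebra O {x : A | sub_set S x} (subalgebra_inhabited S)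
    (fun x y => exist _ (alg_add (sval x) (sval y)) (sub_add (svalP x) (svalP y)))
    (fun x => exist _ (alg_neg (sval x)) (sub_neg (svalP x)))
    (fun o x => exist _ (alg_op o (sval x)) (sub_op o (svalP x))).

Lemma product_inhabited (O I : Type) (A : I -> algebra O) :
  inhabited (forall i, A i).
Proof.
have inhA i : {x : A i | True}.
  by apply: cid; have [x] := carrier_inhabited (A i); exists x.
by exists => i; exact: sval (inhA i).
Qed.

Definition product (O I : Type) (A : I -> algebra O) : algebra O :=
  @Algebra O (forall i, A i) (product_inhabited A)
    (fun x y i => alg_add (x i) (y i))
    (fun x i => alg_neg (x i))
    (fun o x i => alg_op o (x i)).

Definition reduct (O O' : Type) (r : O' -> O) (A : algebra O) : algebra O' :=
  @Algebra O' A (carrier_inhabited A) alg_add alg_neg (fun o => alg_op (r o)).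

Inductive fpa_op (n : nat) :=
  | fpa_c of 'I_n
  | fpa_s of 'I_n & 'I_n
  | fpa_p of 'I_n & 'I_n.

Inductive cs_op (n : nat) :=
  | cs_c of 'I_n
  | cs_s of 'I_n & 'I_n.

Definition cs_to_fpa (n : nat) (o : cs_op n) : fpa_op n :=
  match o with
  | cs_c i => fpa_c i
  | cs_s i j => fpa_s i j
  end.

Definition Rd_cs (n : nat) (A : algebra (fpa_op n)) : algebra (cs_op n) :=
  reduct (@cs_to_fpa n) A.

Section SetAlgebra.
Variables (n : nat) (U : Type).
Implicit Types (s : 'I_n -> U) (R : set ('I_n -> U)).

(* s(i/u) *)
Definition upd s (i : 'I_n) (u : U) : 'I_n -> U :=
  fun k => if k == i then u else s k.

Definition cylindrify (i : 'I_n) R : set ('I_n -> U) :=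
  [set s | exists u, R (upd s i u)].

Definition substitute (i j : 'I_n) R : set ('I_n -> U) :=
  [set s | R (upd s i (s j))].

Definition transpose (i j : 'I_n) R : set ('I_n -> U) :=
  [set s | R (upd (upd s i (s j)) j (s i))].

Definition set_op (o : fpa_op n) : set ('I_n -> U) -> set ('I_n -> U) :=
  match o with
  | fpa_c i => cylindrify i
  | fpa_s i j => substitute i j
  | fpa_p i j => transpose i j
  end.

Definition set_algebra : algebra (fpa_op n) :=
  @Algebra (fpa_op n) (set ('I_n -> U)) (inhabits set0) setU setC set_op.

End SetAlgebra.

Definition RFPA (n : nat) (A : algebra (fpa_op n)) : Prop :=
  exists (I : Type) (U : I -> Type)
         (S : subuniverse (product (fun t => set_algebra n (U t)))),
    isomorphic A (subalgebra S).

(* Types have no literal inclusion of carriers, so "B is a subalgebra of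
   Rd_cs C" is read up to isomorphism; RFPA is closed under isomorphism. *)
Definition S_Rd_cs_RFPA (n : nat) (B : algebra (cs_op n)) : Prop :=
  exists2 C : algebra (fpa_op n), RFPA C &
    exists S : subuniverse (Rd_cs C), isomorphic B (subalgebra S).

Definition op_p (n : nat) (A : algebra (fpa_op n)) (i j : 'I_n) : A -> A :=
  alg_op (fpa_p i j).
Definition op_s (n : nat) (A : algebra (fpa_op n)) (i j : 'I_n) : A -> A :=
  alg_op (fpa_s i j).
Arguments op_p {n A} i j _.
Arguments op_s {n A} i j _.

(* Main.v *)
Require Import Defs.
From mathcomp Require Import boolp classical_sets.
From mathcomp Require Import all_boot fingroup perm.

Set Implicit Arguments.
Unset Strict Implicit.
Unset Printing Implicit Defensive.

(** The equations hold in set algebras by direct computation, where [p_ij] is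
    composition of a sequence with the transposition of [i] and [j].

    Conversely, let [h] embed the reduct of [A] in a product of set algebras,
    and say that [x] holds at a sequence [r] when [r] belongs to a component of
    [h x].  The [p_ij] need not be respected by [h], but three facts about them
    follow from the equations.  First, the [p_ij] generate an action [P] of the
    symmetric group, because the equations present it
    ([transposition_action]).  Second, [p_kl] acts as it should on every value
    of [s_ij] ([acts_as_p]), hence on every cylinder, and it commutes with
    cylindrification up to renaming the coordinate ([p_c]).  Third, and this
    uses the existence of three coordinates, [p_kl] acts as it should at every
    sequence with a repetition ([h_p_repetition]).

    So [h] can go wrong only at sequences [r] without repetitions, where the
    sets of [P s x] that hold at [r] and of [x] that hold at [r \o s] may
    disagree.  The remedy is to trust [h] at one arrangement of each such
    family of entries and to define membership at all others from it through
    [P].  This repairs the [p_ij]; the Boolean operations survive since each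
    [P s] is a Boolean automorphism, and the [s_ij] survive since they look at
    sequences with repetitions only.  Cylindrifications are the difficulty: if
    [c_i x] holds at [r], a value [u] with [x] true at [r(i/u)] is of use only
    if [r(i/u)] is the trusted arrangement of its own entries.  Therefore the
    base set is enlarged beforehand, with a fresh copy of every [u] made for
    every sequence and coordinate, so that [r] with this copy inserted can be
    declared trusted; no two such declarations collide
    ([preferred_unique]). *)

(** * Permutations generated by transpositions *)

Section TranspositionAction.
Variables (T : finType) (X : Type) (p : T -> T -> X -> X).
Hypothesis pxx : forall a x, p a a x = x.
Hypothesis pC : forall a b x, p a b x = p b a x.
Hypothesis pK : forall a b x, p a b (p a b x) = x.
Hypothesis pbraid : forall a b c x, a != b -> a != c -> b != c ->
  p a b (p a c x) = p b c (p a b x).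

(** Only the case of disjoint pairs needs an argument: there [p c d] is
    expanded into three operators that each meet [p a b] in one point. *)
Lemma transposition_conj a b c d x :
  p a b (p c d x) = p (tperm a b c) (tperm a b d) (p a b x).
Proof.
have [<-|ab] := eqVneq a b; first by rewrite !pxx tperm1 !perm1.
have [<-|cd] := eqVneq c d; first by rewrite !pxx.
have nsym (u v : T) : u != v -> v != u by rewrite eq_sym.
have ba := nsym _ _ ab.
case: (tpermP a b c) => [ca|cb|/eqP ca /eqP cb];
  case: (tpermP a b d) => [da|db|/eqP da /eqP db]; subst.
- by rewrite eqxx in cd.
- by rewrite (pC b a).
- by rewrite pbraid // nsym.
- by rewrite (pC b a).
- by rewrite eqxx in cd.
- by rewrite (pC a b) (pbraid _ ba cd (nsym _ _ da)) (pC b a).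
- by rewrite (pC c a) (pbraid _ ab (nsym _ _ ca) (nsym _ _ cb)) (pC b c).
- rewrite (pC c b) (pC a b) (pbraid _ ba (nsym _ _ cb) (nsym _ _ ca)).
  by rewrite (pC a c) (pC b a).
- have [ac bc] := (nsym _ _ ca, nsym _ _ cb).
  have [ad bd] := (nsym _ _ da, nsym _ _ db).
  have split_at e : e != c -> e != d ->
      p c d =1 p e c \o p e d \o p e c.
    by move=> ec ed y; rewrite /= (pbraid _ ec ed cd) pK.
  rewrite (split_at a) //= (pbraid _ ab ac bc) (pbraid _ ab ad bd).
  rewrite (pbraid _ ab ac bc).
  by rewrite (split_at b).
Qed.

Definition word_act (w : seq (T * T)) (x : X) : X :=
  foldr (fun ab => p ab.1 ab.2) x w.

(** The product is reversed because [(s * t)%g] applies [s] first, whereas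
    [word_act] applies the last letter first. *)
Definition word_perm (w : seq (T * T)) : {perm T} :=
  foldr (fun ab s => s * tperm ab.1 ab.2)%g 1%g w.

Definition word_in (D : {set T}) (w : seq (T * T)) : bool :=
  all (fun ab => (ab.1 \in D) && (ab.2 \in D)) w.

(** All letters that move the point [m] can be collected into a single one at
    the left end, which then decides whether the permutation fixes [m]. *)
Lemma word_collect (D : {set T}) m w : m \in D -> word_in D w ->
  exists a w', [/\ a \in D, word_in (D :\ m) w',
    forall x, word_act w x = p a m (word_act w' x)
    & word_perm w = (word_perm w' * tperm a m)%g].
Proof.
move=> mD; elim: w => [|[c d] w IHw] /=.
  by move=> _; exists m, [::]; split=> [||x|] /=; rewrite ?pxx ?tperm1 ?mulg1.
case/andP=> /andP[cD dD] /IHw [a [w' [aD w'D actw permw]]].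
(* A new letter through [m] meets the collected one: they cancel, or one of
   them is trivial, or the braid relation moves [m] out of one of them. *)
have touch e : e \in D -> exists b v, [/\ b \in D, word_in (D :\ m) v,
    forall x, p e m (word_act w x) = p b m (word_act v x)
    & (word_perm w * tperm e m = word_perm v * tperm b m)%g].
  move=> eD; have [ea|ea] := eqVneq e a.
    exists m, w'; split=> [||x|] //; first by rewrite actw ea pK pxx.
    by rewrite permw ea -mulgA tperm2 tperm1.
  have [am|am] := eqVneq a m.
    exists e, w'; split=> [||x|] //; first by rewrite actw am pxx.
    by rewrite permw am tperm1 mulg1.
  have [em|em] := eqVneq e m.
    exists a, w'; split=> [||x|] //; first by rewrite actw em pxx.
    by rewrite permw em tperm1 mulg1.
  exists a, ((e, a) :: w'); split=> //=.
  - by rewrite !inE am em aD eD.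
  - by move=> x; rewrite actw (pC e m) (pC e a) pbraid // eq_sym.
  - rewrite permw -!mulgA; congr (_ * _)%g.
    by rewrite [RHS]conjgC tpermJ tpermL tpermD // eq_sym.
have [dm|dm] := eqVneq d m; first by rewrite dm; exact: touch.
have [cm|cm] := eqVneq c m.
  have [b [v [bD vD actv permv]]] := touch d dD.
  exists b, v; split=> [||x|] //; first by rewrite cm pC.
  by rewrite cm tpermC.
exists (tperm c d a), ((c, d) :: w'); split=> //=.
- by case: tpermP.
- by rewrite !inE cm dm cD dD.
- by move=> x; rewrite actw transposition_conj (@tpermD _ c d m).
- rewrite permw -!mulgA; congr (_ * _)%g.
  by rewrite conjgC tpermJ (@tpermD _ c d m).
Qed.

(** By induction on the support [D]: the letter collected at a point [m] is
    trivial since the permutation and the rest of the word both fix [m]. *)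
Lemma word_act_trivial w : word_perm w = 1%g -> forall x, word_act w x = x.
Proof.
have: word_in setT w by apply/allP => ab _; rewrite !inE.
move: {2}#|_| (leqnn #|[set: T]|) => k; move: setT => D.
elim: k D w => [|k IHk] D w leDk wD permw x.
  move: leDk wD; rewrite leqn0 cards_eq0 => /eqP ->.
  by case: w permw => //= ab w _; rewrite inE.
have [D0|[m mD]] := set_0Vmem D; first by apply: (IHk D); rewrite // D0 cards0.
have [a [w' [aD w'D actw permw']]] := word_collect mD wD.
have mfix : word_perm w' m = m.
  elim: (w') w'D {actw permw'} => [|[c d] v IHv] /=; first by rewrite perm1.
  case/andP=> /andP[cm dm] /IHv vm; rewrite permM vm.
  by move: cm dm; rewrite !inE => /andP[cm _] /andP[dm _]; rewrite tpermD.
have am : a = m.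
  by have:= permM (word_perm w') (tperm a m) m; rewrite -permw' permw perm1 mfix tpermR.
rewrite actw am pxx; apply: (IHk (D :\ m)) => //.
  by rewrite -ltnS (leq_trans _ leDk) // [X in _ < X](cardsD1 m) mD.
by move: permw'; rewrite permw am tperm1 mulg1.
Qed.

Lemma word_act_perm w w' : word_perm w = word_perm w' ->
  forall x, word_act w x = word_act w' x.
Proof.
have act_cat u v x : word_act (u ++ v) x = word_act u (word_act v x).
  exact: foldr_cat.
have perm_cat u v : word_perm (u ++ v) = (word_perm v * word_perm u)%g.
  by elim: u => /= [|ab u ->]; rewrite ?mulg1 ?mulgA.
have act_rev u x : word_act (rev u) (word_act u x) = x.
  elim: u x => //= ab u IHu x.
  by rewrite rev_cons -cats1 act_cat /= pK.
have perm_rev u : (word_perm u * word_perm (rev u))%g = 1%g.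
  elim: u => [|ab u IHu]; first by rewrite mulg1.
  by rewrite rev_cons -cats1 perm_cat /= mul1g -mulgA (mulgA (tperm _ _)) tperm2 mul1g.
move=> eqw x; rewrite -[LHS](act_rev (rev w')) revK -(act_cat (rev w')).
by rewrite (@word_act_trivial (rev w' ++ w)) // perm_cat eqw perm_rev.
Qed.

(** The defining relations of the transpositions present the symmetric
    group, so [p] extends to an action of all permutations. *)
Lemma transposition_action : exists P : {perm T} -> X -> X,
  [/\ forall x, P 1%g x = x,
      forall a b x, P (tperm a b) x = p a b x
    & forall s t x, P (s * t)%g x = P t (P s x)].
Proof.
have permw (s : {perm T}) : exists w, word_perm w = s.
  have [ts -> _] := prod_tpermP s; elim: ts => [|ab ts [w IHw]].
    by exists [::]; rewrite big_nil.
  exists (rcons w ab); rewrite big_cons -IHw {s IHw}.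
  by elim: w => /= [|cd w ->]; rewrite ?mul1g ?mulg1 ?mulgA.
have [word wordP] := choice permw.
exists (word_act \o word); split=> [x|a b x|s t x] /=.
- by rewrite (@word_act_perm _ [::]) ?wordP.
- by rewrite (@word_act_perm _ [:: (a, b)]) ?wordP //= mul1g.
- rewrite (@word_act_perm _ (word t ++ word s)); first exact: foldr_cat.
  rewrite wordP -{1}[s]wordP -{1}[t]wordP.
  by elim: (word t) => /= [|ab u <-]; rewrite ?mulg1 ?mulgA.
Qed.

End TranspositionAction.

(** * Embeddings into set algebras *)

Lemma isomorphic_subalgebraP (O : Type) (A B : algebra O) :
  (exists S : subuniverse B, isomorphic A (subalgebra S)) <->
  (exists2 h : A -> B, is_hom h & injective h).
Proof.
split=> [[S [f [fD fN fop] /bij_inj f_inj]]|[h [hD hN hop] h_inj]].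
  exists (fun x => sval (f x)); last first.
    move=> x y eqf; apply: f_inj; case: (f x) (f y) eqf => [u Su] [v Sv] /= uv.
    by subst v; congr exist; apply: Prop_irrelevance.
  by split=> [x y|x|o x]; rewrite ?fD ?fN ?fop.
pose R (y : B) := exists x, h x = y.
have RD x y : R x -> R y -> R (alg_add x y).
  by move=> [a <-] [b <-]; exists (alg_add a b); rewrite hD.
have RN x : R x -> R (alg_neg x) by move=> [a <-]; exists (alg_neg a); rewrite hN.
have Rop o x : R x -> R (alg_op o x).
  by move=> [a <-]; exists (alg_op o a); rewrite hop.
have R0 : exists y, R y by have [x] := carrier_inhabited A; exists (h x), x.
exists (Subuniverse R0 RD RN Rop).
have ext (u v : {y | R y}) : sval u = sval v -> u = v.
  case: u v => [u Ru] [v Rv] /= uv; subst v.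
  by congr exist; apply: Prop_irrelevance.
exists (fun x => exist R (h x) (ex_intro _ x erefl)).
  by split=> [x y|x|o x]; apply: ext; rewrite /= ?hD ?hN ?hop.
pose g (u : {y | R y}) : A := sval (cid (svalP u)).
have gK (u : {y | R y}) : h (g u) = sval u := svalP (cid (svalP u)).
exists g => [x|u]; first by apply: h_inj; rewrite gK.
by apply: ext; rewrite /= gK.
Qed.

Lemma RFPA_embedding n (A : algebra (fpa_op n)) : RFPA A <->
  exists I (U : I -> Type) (h : A -> product (fun t => set_algebra n (U t))),
    is_hom h /\ injective h.
Proof.
split=> [[I [U /isomorphic_subalgebraP[h hh hi]]]|[I [U [h [hh hi]]]]].
  by exists I, U, h.
by exists I, U; apply/isomorphic_subalgebraP; exists h.
Qed.

Lemma S_Rd_cs_RFPA_embedding n (A : algebra (fpa_op n)) :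
  S_Rd_cs_RFPA (Rd_cs A) -> exists I (U : I -> Type)
    (h : A -> product (fun t => set_algebra n (U t))),
    is_hom (h : Rd_cs A -> Rd_cs (product _)) /\ injective h.
Proof.
move=> [C /RFPA_embedding[I [U [g [[gD gN gop] g_inj]]]]].
move=> /isomorphic_subalgebraP[f [fD fN fop] f_inj].
exists I, U, (g \o f); split; last exact: inj_comp.
by split=> [x y|x|o x] /=; rewrite ?fD ?fN ?fop /= ?gD ?gN ?gop.
Qed.

Lemma RFPA_reduct n (A : algebra (fpa_op n)) : RFPA A -> S_Rd_cs_RFPA (Rd_cs A).
Proof.
by exists A => //; apply/isomorphic_subalgebraP; exists id; [split|].
Qed.

Definition repl n (i j : 'I_n) : 'I_n -> 'I_n := upd id i j.
Arguments repl : simpl never.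

Lemma substituteE n U i j (R : set ('I_n -> U)) s :
  substitute i j R s = R (s \o repl i j).
Proof.
by congr R; apply/funext => k; rewrite /= /repl /upd; case: ifP.
Qed.

Lemma transposeE n U i j (R : set ('I_n -> U)) s :
  transpose i j R s = R (s \o tperm i j).
Proof.
congr R; apply/funext => k; rewrite /= /upd.
case: tpermP => [->|->|/eqP ki /eqP kj].
- by rewrite eqxx; case: eqVneq => // ->.
- by rewrite eqxx.
- by rewrite (negPf ki) (negPf kj).
Qed.

Lemma RFPA_transposition_equations n (A : algebra (fpa_op n)) : RFPA A ->
  forall i j k : 'I_n, i != j -> i != k -> j != k ->
     (forall x y : A, op_p i j (alg_add x y) = alg_add (op_p i j x) (op_p i j y)) /\
     (forall x : A, op_p i j (alg_neg x) = alg_neg (op_p i j x)) /\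
     (forall x : A, op_p i j (op_p i j x) = x) /\
     (forall x : A, op_p i j x = op_p j i x) /\
     (forall x : A, op_p i i x = x) /\
     (forall x : A, op_p i j (op_s j i x) = op_s i j x) /\
     (forall x : A, op_p i j (op_p i k x) = op_p j k (op_p i j x)).
Proof.
move=> /RFPA_embedding[I [U [h [[hD hN hop] h_inj]]]] i j k ij ik jk.
have ext (x y : A) : (forall t s, h x t s = h y t s) -> x = y.
  by move=> eqh; apply: h_inj; apply: functional_extensionality_dep => t; apply/funext.
have hP a b (x : A) t s : h (op_p a b x) t s = h x t (s \o tperm a b).
  by rewrite /op_p hop -transposeE.
have hS a b (x : A) t s : h (op_s a b x) t s = h x t (s \o repl a b).
  by rewrite /op_s hop -substituteE.
have hPD a b (x y : A) : op_p a b (alg_add x y) = alg_add (op_p a b x) (op_p a b y).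
  by apply: ext => t s; rewrite hP !hD /= /setU /= !hP.
have hPN a b (x : A) : op_p a b (alg_neg x) = alg_neg (op_p a b x).
  by apply: ext => t s; rewrite hP !hN /= /setC /= !hP.
split; last split; last split; last split; last split; last split; move=> x //.
- by apply: ext => t s; rewrite !hP; congr h; apply/funext => l /=; rewrite tpermK.
- by apply: ext => t s; rewrite !hP tpermC.
- by apply: ext => t s; rewrite hP tperm1; congr h; apply/funext => l /=; rewrite perm1.
- apply: ext => t s; rewrite hP !hS; congr h; apply/funext => l /=; congr s.
  rewrite /repl /upd; case: (eqVneq l i) => [->|li].
    by rewrite (negPf ij) tpermL.
  case: (eqVneq l j) => [->|lj]; first by rewrite tpermL.
  by rewrite tpermD // eq_sym.
- apply: ext => t s; rewrite !hP; congr h; apply/funext => l /=; congr s.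
  have := conjgC (tperm i k) (tperm i j).
  rewrite tpermJ tpermL tpermD // => /permP/(_ l).
  by rewrite !permM.
Qed.

(** * Sequences of free witnesses *)

(** A new base set over a base set [V] of colours.  The point [wit r j u] is
    reserved as the value of colour [u] to be put at coordinate [j] of the
    sequence [r]; the points [base k v] make up, for each sequence of colours,
    one sequence of points over it. *)
Inductive point (n : nat) (V : Type) :=
  | base of 'I_n & V
  | wit of ('I_n -> point n V) & 'I_n & V.

Section Points.
Variables (n : nat) (V : Type).
Implicit Types (r : 'I_n -> point n V) (s : {perm 'I_n}).

Definition colour (w : point n V) : V :=
  match w with base _ v => v | wit _ _ v => v end.

(** Two witnesses cannot be entries of each other's sequences, each being then
    a proper subterm of the other. *)
Lemma wit_acyclic w r j u r' j' u' k k' : w = wit r j u ->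
  r k = wit r' j' u' -> r' k' = w -> False.
Proof.
elim: w r j u r' j' u' k k' => [//|r0 IH j0 u0] r j u r' j' u' k k' [<- _ _].
by move=> rk r'k'; exact: (IH k r' j' u' r0 j0 u0 k' k rk r'k').
Qed.

(** The arrangements of their entries that will be preferred: the point
    [wit r j u] is meant for the sequence [r] as it stands. *)
Definition preferred r : Prop :=
  (exists v : 'I_n -> V, r = fun k => base k (v k)) \/
  (exists r' j u, r = upd r' j (wit r' j u)).

(** If both arrangements contain a witness for themselves, then either these
    are the same witness, which determines the arrangement, or each of them is
    an entry of the sequence of the other.  For sequences of points [base k v]
    the label [k] determines the place. *)
Lemma preferred_unique r s : preferred r -> preferred (r \o s) -> r \o s = r.
Proof.
move=> [[v ->]|[r1 [j1 [u1 r1E]]]] [[v2 e2]|[r2 [j2 [u2 e2]]]].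
- have s1 k : s k = k by have /(congr1 (fun f => f k))/= [] := e2.
  by apply/funext => k /=; rewrite s1.
- by have /(congr1 (fun f => f j2)) := e2; rewrite /upd eqxx.
- by have /(congr1 (fun f => f ((s^-1)%g j1))) := e2; rewrite r1E /upd /= permKV eqxx.
have at1 : r j1 = wit r1 j1 u1 by rewrite r1E /upd eqxx.
have at2 : r (s j2) = wit r2 j2 u2.
  by have /(congr1 (fun f => f j2)) := e2; rewrite /upd eqxx.
have [sj|sj] := eqVneq (s j2) j1.
  by move: at2; rewrite sj at1 e2 r1E => -[<- <- <-].
have off1 : r1 (s j2) = wit r2 j2 u2 by rewrite -at2 r1E /upd (negPf sj).
have off2 : r2 ((s^-1)%g j1) = wit r1 j1 u1.
  have /(congr1 (fun f => f ((s^-1)%g j1))) := e2.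
  rewrite /upd /= permKV at1; case: eqVneq => // e.
  by rewrite -e permKV eqxx in sj.
by case: (wit_acyclic erefl off1 off2).
Qed.

(** One arrangement is chosen for each family of entries, a preferred one if
    there is any.  The choice is made from a set of arrangements that is the
    same for all members of an orbit, so it is constant on orbits. *)
Lemma arrangement : exists rep : ('I_n -> point n V) -> 'I_n -> point n V,
  [/\ forall r, exists s, r = rep r \o s,
      forall r s, rep (r \o s) = rep r
    & forall r, preferred r -> rep r = r].
Proof.
pose good r r' := (exists s, r = r' \o s) /\
  ((exists s, preferred (r \o s)) -> preferred r').
have good_ex r : exists r', good r r'.
  have [[s prs]|npr] := EM (exists s, preferred (r \o s)).
    exists (r \o s); split=> //; exists (s^-1)%g.
    by apply/funext => k /=; rewrite permKV.
  exists r; split=> //; exists 1%g.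
  by apply/funext => k /=; rewrite perm1.
have good_orbit r s : good (r \o s) = good r.
  apply/funext => r'; apply/propext; split=> -[[t e] pr]; split.
  - exists (s^-1 * t)%g; apply/funext => k /=.
    by rewrite permM -[RHS]/((r' \o t) _) -e /= permKV.
  - move=> [t' prt]; apply: pr; exists (t' * s^-1)%g.
    by congr preferred: prt; apply/funext => k /=; rewrite permM permKV.
  - by exists (s * t)%g; apply/funext => k /=; rewrite e /= permM.
  - move=> [t' prt]; apply: pr; exists (t' * s)%g.
    by congr preferred: prt; apply/funext => k /=; rewrite permM.
pose rep r := if pselect (exists r', good r r') is left e
  then sval (cid e) else r.
have repP r : good r (rep r).
  by rewrite /rep; case: pselect => [e|/(_ (good_ex r))//]; exact: svalP.
exists rep; split=> [r|r s|r pr].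
- by have [] := repP r.
- by rewrite /rep good_orbit; case: pselect => // /(_ (good_ex r)).
- have [[s e] prep] := repP r.
  rewrite [RHS]e preferred_unique -?e //.
  by apply: prep; exists 1%g; congr preferred: pr; apply/funext => k /=; rewrite perm1.
Qed.

End Points.

(** * Sequences in a representation of the reduct *)

Section Repair.
Variables (n : nat) (n_ge3 : 2 < n) (A : algebra (fpa_op n)).
Variables (I : Type) (U : I -> Type).
Variable h : A -> product (fun t => set_algebra n (U t)).
Arguments h : clear implicits.
Hypothesis h_hom : is_hom (h : Rd_cs A -> Rd_cs (product _)).
Hypothesis h_inj : injective h.
Hypothesis pD : forall i j (x y : A),
  op_p i j (alg_add x y) = alg_add (op_p i j x) (op_p i j y).
Hypothesis pN : forall i j (x : A), op_p i j (alg_neg x) = alg_neg (op_p i j x).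
Hypothesis pK : forall i j (x : A), op_p i j (op_p i j x) = x.
Hypothesis pC : forall i j (x : A), op_p i j x = op_p j i x.
Hypothesis pii : forall i (x : A), op_p i i x = x.
Hypothesis ps : forall i j (x : A), i != j -> op_p i j (op_s j i x) = op_s i j x.
Hypothesis pbraid : forall i j k (x : A), i != j -> i != k -> j != k ->
  op_p i j (op_p i k x) = op_p j k (op_p i j x).

Implicit Types (i j k l m : 'I_n) (x y z : A) (s t : {perm 'I_n}) (q : I).

Definition op_c i x : A := alg_op (fpa_c i) x.

Lemma h_add x y q r : h (alg_add x y) q r = (h x q r \/ h y q r).
Proof. by case: h_hom => hD _ _; rewrite hD. Qed.

Lemma h_neg x q r : h (alg_neg x) q r = (~ h x q r).
Proof. by case: h_hom => _ hN _; rewrite hN. Qed.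

Lemma h_c i x q r : h (op_c i x) q r = exists u, h x q (upd r i u).
Proof. by case: h_hom => _ _ /(_ (cs_c i) x) hC; rewrite [h _]hC. Qed.

Lemma h_s i j x q r : h (op_s i j x) q r = h x q (r \o repl i j).
Proof.
by case: h_hom => _ _ /(_ (cs_s i j) x) hS; rewrite [h _]hS -substituteE.
Qed.

Lemma h_ext x y : (forall q r, h x q r = h y q r) -> x = y.
Proof.
move=> eqh; apply: h_inj; apply: functional_extensionality_dep => q.
exact/funext/eqh.
Qed.

Definition le x y := forall q r, h x q r -> h y q r.

Lemma le_addE x y : le x y <-> alg_add x y = y.
Proof.
split=> [lexy|<- q r]; last by rewrite h_add; left.
by apply: h_ext => q r; rewrite h_add; apply/propext; split=> [[/lexy|]|]; auto.
Qed.

Lemma le_anti x y : le x y -> le y x -> x = y.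
Proof. by move=> xy yx; apply: h_ext => q r; apply/propext; split; auto. Qed.

Lemma le_p i j x y : le x y -> le (op_p i j x) (op_p i j y).
Proof. by move=> /le_addE xy; apply/le_addE; rewrite -pD xy. Qed.

Lemma le_c i x : le x (op_c i x).
Proof.
move=> q r hx; rewrite h_c; exists (r i); congr (h x q _): hx.
by apply/funext => k; rewrite /upd; case: eqVneq => // ->.
Qed.

Lemma repl_l i j : repl i j i = j. Proof. by rewrite /repl /upd eqxx. Qed.
Lemma repl_D i j k : k != i -> repl i j k = k.
Proof. by rewrite /repl /upd => /negPf ->. Qed.

(** Cylinders are values of substitutions; this is what makes the action of
    [p_kl] on them known. *)
Lemma s_c i j x : op_s i j (op_c i x) = op_c i x.
Proof.
apply: h_ext => q r; rewrite h_s !h_c; congr ex; apply/funext => u.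
congr (h x q _); apply/funext => k; rewrite /upd /=.
by case: eqVneq => // ki; rewrite repl_D.
Qed.

Lemma sii i x : op_s i i x = x.
Proof.
apply: h_ext => q r; rewrite h_s; congr (h x q _); apply/funext => k /=.
by have [->|ki] := eqVneq k i; rewrite ?repl_l ?repl_D.
Qed.

Lemma third i j : exists k, k != i /\ k != j.
Proof.
have : #|~: [set i; j]| != 0.
  rewrite -lt0n cardsCs setCK subn_gt0 card_ord.
  by apply: leq_ltn_trans n_ge3; rewrite cards2; case: (_ != _).
rewrite cards_eq0 => /set0Pn[k]; rewrite !inE negb_or => /andP[ki kj].
by exists k.
Qed.

(** What it means for an operation of [A] to be the substitution along [c] in
    every component of [h]; here [c] may be any composite of replacements and
    transpositions. *)
Definition acts_as (f : A -> A) (c : 'I_n -> 'I_n) :=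
  forall x q r, h (f x) q r = h x q (r \o c).

(** If [c] misses [i], then [f = s_ij f], so that [p_ij] applied to [f] is
    known from [p_ij s_ij = s_ji]; likewise for [j].  If it misses another
    point [m], the transposition of [i] and [j] is the product of three, and
    each of them moves the point missed at its stage. *)
Lemma acts_as_p i j m f c : acts_as f c -> (forall k, c k != m) ->
  acts_as (op_p i j \o f) (tperm i j \o c).
Proof.
have missed k l g d : k != l -> acts_as g d -> (forall a, d a != k) ->
    acts_as (op_p k l \o g) (tperm k l \o d).
  move=> kl gd dk x q r /=.
  have -> : g x = op_s k l (g x).
    apply: h_ext => q' r'; rewrite h_s !gd; congr (h x _ _); apply/funext => a /=.
    by rewrite repl_D.
  rewrite pC ps 1?eq_sym // h_s gd; congr (h x _ _); apply/funext => a /=.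
  have [->|dal] := eqVneq (d a) l; first by rewrite repl_l tpermR.
  by rewrite repl_D // tpermD // eq_sym.
move=> fc cm; have [<-|ij] := eqVneq i j.
  by move=> x q r /=; rewrite pii fc; congr (h x q _); apply/funext => k /=;
     rewrite tperm1 perm1.
have [im|im] := eqVneq i m; first by apply: missed => // a; rewrite im.
have [jm|jm] := eqVneq j m.
  move=> x q r; rewrite /= pC tpermC; apply: (missed j i f c) => //.
    by rewrite eq_sym.
  by move=> a; rewrite jm.
have mi : m != i by rewrite eq_sym.
have mj : m != j by rewrite eq_sym.
have f1 := missed m i f c mi fc cm.
have c1 a : tperm m i (c a) != i.
  by rewrite -{2}[i](tpermL m) (inj_eq perm_inj).
have f2 := missed i j _ _ ij f1 c1.
have c2 a : tperm i j (tperm m i (c a)) != j.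
  by rewrite -{2}[j](tpermL i) (inj_eq perm_inj).
have f3 := missed j m _ _ jm f2 c2.
move=> x q r /=; have := f3 x q r; rewrite /=.
rewrite (pC m i) pbraid // pK => ->; congr (h x q _); apply/funext => a /=.
congr r; have := conjgC (tperm i m) (tperm i j).
rewrite tpermJ tpermL (@tpermD _ i j m) // => /permP/(_ (c a)).
by rewrite (tpermC m i) !permM => ->; rewrite tpermK.
Qed.

(** * Cylinders and repetitions *)

(** The value of [p_ij] at a cylinder in direction [m] is a cylinder in the
    image direction, and it lies above [p_ij x]; [op_c] of [p_ij x] is the least
    such element. *)
Lemma c_le_p i j m x :
  le (op_c (tperm i j m) (op_p i j x)) (op_p i j (op_c m x)).
Proof.
have [l [lm _]] := third m m.
have cc q u r : h (op_p i j (op_c m x)) q (upd r (tperm i j m) u) =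
                h (op_p i j (op_c m x)) q r.
  rewrite -(s_c m l).
  have act : acts_as (op_p i j \o op_s m l) (tperm i j \o repl m l).
    apply: (@acts_as_p i j m); first by move=> y q' r'; rewrite h_s.
    move=> k; have [->|km] := eqVneq k m; first by rewrite repl_l.
    by rewrite repl_D.
  rewrite !(act _ q); congr (h _ q _); apply/funext => k /=.
  rewrite /upd (inj_eq perm_inj).
  have [->|km] := eqVneq k m; first by rewrite repl_l (negPf lm).
  by rewrite repl_D // (negPf km).
move=> q r; rewrite h_c => -[u].
by move/(@le_p i j _ _ (@le_c m x)); rewrite cc.
Qed.

Lemma p_c i j m x :
  op_p i j (op_c m x) = op_c (tperm i j m) (op_p i j x).
Proof.
apply: le_anti; last exact: c_le_p.
have := @c_le_p i j (tperm i j m) (op_p i j x).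
by rewrite tpermK pK => /(@le_p i j); rewrite pK.
Qed.

(** In the reduct alone nothing ties [p_ij x] to [x] at a sequence without
    repetition.  At a sequence with equal entries at [k] and [l] it does:
    [x . - s_ab x], with [a], [b] the images of [k] and [l], holds at no
    sequence with equal entries at [a] and [b], and neither does its cylinder
    in a third direction [m]; but [p_ij] of that cylinder is known. *)
Lemma h_p_repetition i j k l x q r : k != l -> r k = r l ->
  h (op_p i j x) q r = h x q (r \o tperm i j).
Proof.
move=> kl rkl.
pose a := tperm i j k; pose b := tperm i j l.
have ab : a != b by rewrite (inj_eq perm_inj).
have [m [ma mb]] := third a b.
have half y : h (op_p i j y) q r -> h y q (r \o tperm i j).
  move=> hpy; apply: contrapT => nhy.
  pose nz := alg_add (alg_neg y) (op_s a b y); pose z := alg_neg nz.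
  have zN q' r' : r' a = r' b -> ~ h z q' r'.
    move=> r'ab; rewrite /z /nz h_neg h_add h_neg h_s; apply; rewrite orC.
    have -> : r' \o repl a b = r'; last exact: EM.
    apply/funext => c /=.
    by have [->|ca] := eqVneq c a; rewrite ?repl_l ?repl_D.
  have pz : h (op_p i j z) q r.
    rewrite pN pD pN h_neg h_add h_neg => -[]; first exact.
    have act : acts_as (op_p i j \o op_s a b) (tperm i j \o repl a b).
      apply: (@acts_as_p i j a); first by move=> y' q' r'; rewrite h_s.
      move=> c; have [->|ca] := eqVneq c a; first by rewrite repl_l eq_sym.
      by rewrite repl_D.
    rewrite [h _ _ _](act y q r); apply: contra_not nhy.
    congr (h y q _); apply/funext => c /=.
    have [->|ca] := eqVneq c a; last by rewrite repl_D.
    by rewrite repl_l !tpermK.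
  have : h (op_p i j (op_c m z)) q r by exact: (@le_p i j _ _ (@le_c m z)) pz.
  rewrite -(s_c m a).
  have act : acts_as (op_p i j \o op_s m a) (tperm i j \o repl m a).
    apply: (@acts_as_p i j m); first by move=> y' q' r'; rewrite h_s.
    move=> c; have [->|cm] := eqVneq c m; first by rewrite repl_l eq_sym.
    by rewrite repl_D.
  rewrite [h _ _ _](act (op_c m z) q r).
  rewrite -[h _ _ _](h_s m a (op_c m z) (r \o tperm i j)) s_c h_c => -[u].
  apply: zN; rewrite /upd eq_sym (negPf ma) eq_sym (negPf mb) /=.
  by rewrite /a /b !tpermK.
apply/propext; split; first exact: half.
have := half (alg_neg x); rewrite pN !h_neg => nhalf hx.
by apply: contrapT => /nhalf.
Qed.

(** * The action of all permutations *)

Variable P : {perm 'I_n} -> A -> A.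
Hypothesis P1 : forall x, P 1%g x = x.
Hypothesis P_tperm : forall i j x, P (tperm i j) x = op_p i j x.
Hypothesis PM : forall s t x, P (s * t)%g x = P t (P s x).

Lemma perm_ind (Q : {perm 'I_n} -> Prop) : Q 1%g ->
  (forall i j s, Q s -> Q (s * tperm i j)%g) -> forall s, Q s.
Proof.
move=> Q1 QM s; rewrite -[s]invgK; have [w -> _] := prod_tpermP s^-1%g.
elim: w => [|[i j] w IHw]; first by rewrite big_nil invg1.
by rewrite big_cons invMg tpermV; apply: QM.
Qed.

Lemma PMtperm s i j x : P (s * tperm i j)%g x = op_p i j (P s x).
Proof. by rewrite PM P_tperm. Qed.

Lemma P_add s x y : P s (alg_add x y) = alg_add (P s x) (P s y).
Proof.
by elim/perm_ind: s => [|i j s IHs]; rewrite ?P1 // !PMtperm IHs pD.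
Qed.

Lemma P_neg s x : P s (alg_neg x) = alg_neg (P s x).
Proof.
by elim/perm_ind: s => [|i j s IHs]; rewrite ?P1 // !PMtperm IHs pN.
Qed.

Lemma P_c s i x : P s (op_c i x) = op_c (s i) (P s x).
Proof.
elim/perm_ind: s => [|i' j s IHs]; first by rewrite !P1 perm1.
by rewrite !PMtperm IHs p_c permM.
Qed.

Lemma P_p s i j x : P s (op_p i j x) = P (tperm i j * s)%g x.
Proof. by rewrite PM P_tperm. Qed.

Lemma h_P_s s i j x q r : i != j ->
  h (P s (op_s i j x)) q r = h x q (r \o s \o repl i j).
Proof.
move=> ij; have act : acts_as (P s \o op_s i j) (s \o repl i j).
  elim/perm_ind: s => [|k l s IHs] y q' r' /=.
    rewrite P1 h_s; congr (h y _ _); apply/funext => a /=.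
    by rewrite perm1.
  have {}IHs : acts_as (op_p k l \o (P s \o op_s i j))
      (tperm k l \o (s \o repl i j)).
    apply: (@acts_as_p k l (s i)) => // a /=; rewrite (inj_eq perm_inj).
    by have [->|ai] := eqVneq a i; rewrite ?repl_l ?repl_D // eq_sym.
  rewrite PMtperm [LHS](IHs y q' r'); congr (h y _ _); apply/funext => a /=.
  by rewrite permM.
exact: act.
Qed.

Lemma h_P_repetition s k l x q r : k != l -> r k = r l ->
  h (P s x) q r = h x q (r \o s).
Proof.
move=> kl rkl; elim/perm_ind: s k l r kl rkl => [|i j s IHs] k l r kl rkl.
  by rewrite P1; congr (h x q _); apply/funext => a /=; rewrite perm1.
rewrite PMtperm (@h_p_repetition i j k l) //.
rewrite (IHs (tperm i j k) (tperm i j l)) ?(inj_eq perm_inj) //=; last first.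
  by rewrite !tpermK.
by congr (h x q _); apply/funext => a /=; rewrite permM.
Qed.

(** * The repaired representation *)

Definition rep q : ('I_n -> point n (U q)) -> 'I_n -> point n (U q) :=
  sval (cid (arrangement n (U q))).

Lemma rep_ex q (r : 'I_n -> point n (U q)) :
  exists s : {perm 'I_n}, r = rep r \o s.
Proof. by case: (svalP (cid (arrangement n (U q)))) => + _ _; apply. Qed.

Lemma rep_orbit q (r : 'I_n -> point n (U q)) (s : {perm 'I_n}) :
  rep (r \o s) = rep r.
Proof. by case: (svalP (cid (arrangement n (U q)))) => _ + _; apply. Qed.

Lemma rep_preferred q (r : 'I_n -> point n (U q)) : preferred r -> rep r = r.
Proof. by case: (svalP (cid (arrangement n (U q)))) => _ _; apply. Qed.

(** Membership at [r] is read off from [h] at the trusted arrangement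
    [rep r] only. *)
Definition repaired (x : A) : product (fun q => set_algebra n (point n (U q))) :=
  fun q r => exists s : {perm 'I_n},
    r = rep r \o s /\ h (P s x) q (@colour n (U q) \o rep r).

(** If two permutations carry [rep r] to [r], then [rep r] has a repetition,
    where [P] agrees with composition and the choice does not matter. *)
Lemma repairedE x q (r : 'I_n -> point n (U q)) (s : {perm 'I_n}) :
  r = rep r \o s -> repaired x r = h (P s x) q (@colour n (U q) \o rep r).
Proof.
move=> rs; apply/propext; split=> [[s' [rs' hx]]|hx]; last by exists s.
have [rep_inj|] := EM (injective (rep r)).
  suff -> : s = s' by [].
  apply/permP => k; apply: rep_inj.
  by rewrite -[LHS]/((rep r \o s) k) -rs {1}rs'.
move=> ninj; have [k [l [kl rkl]]] : exists k l, k != l /\ rep r k = rep r l.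
  apply: contrapT => no; apply: ninj => k l rkl; apply/eqP/negPn/negP => kl.
  by apply: no; exists k, l.
have crkl : (@colour n (U q) \o rep r) k = (@colour n (U q) \o rep r) l.
  by rewrite /= rkl.
by move: hx; rewrite !(h_P_repetition _ _ kl crkl) -[_ \o s]compA -[_ \o s']compA -rs -rs'.
Qed.

(** At repetitions the repaired representation is the given one. *)
Lemma repaired_repetition x q (r : 'I_n -> point n (U q)) k l :
  k != l -> r k = r l -> repaired x r = h x q (@colour n (U q) \o r).
Proof.
move=> kl rkl; have [s rs] := rep_ex r; rewrite (repairedE x rs).
rewrite (@h_P_repetition s (s k) (s l)) ?(inj_eq perm_inj) //.
  by congr (h x q _); rewrite {2}rs.
by move: rkl; rewrite {1 2}rs /= => ->.
Qed.

Lemma repaired_add x y : repaired (alg_add x y) = alg_add (repaired x) (repaired y).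
Proof.
apply: functional_extensionality_dep => q; apply/funext => r.
have [s rs] := rep_ex r.
by rewrite /= /setU /= !(repairedE _ rs) P_add h_add.
Qed.

Lemma repaired_neg x : repaired (alg_neg x) = alg_neg (repaired x).
Proof.
apply: functional_extensionality_dep => q; apply/funext => r.
have [s rs] := rep_ex r.
by rewrite /= /setC /= !(repairedE _ rs) P_neg h_neg.
Qed.

Lemma repaired_p i j x q (r : 'I_n -> point n (U q)) :
  repaired (op_p i j x) r = repaired x (r \o tperm i j).
Proof.
have [s rs] := rep_ex r; rewrite (repairedE _ rs) P_p.
have rs' : r \o tperm i j = rep (r \o tperm i j) \o (tperm i j * s)%g.
  by rewrite rep_orbit {1}rs; apply/funext => k /=; rewrite permM.
by rewrite (repairedE _ rs') rep_orbit.
Qed.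

Lemma repaired_s i j x q (r : 'I_n -> point n (U q)) :
  repaired (op_s i j x) r = repaired x (r \o repl i j).
Proof.
have [<-|ij] := eqVneq i j.
  rewrite sii; congr (repaired x _); apply/funext => k /=.
  by have [->|ki] := eqVneq k i; rewrite ?repl_l ?repl_D.
have [s rs] := rep_ex r; rewrite (repairedE _ rs) h_P_s //.
rewrite (@repaired_repetition x q _ i j ij) /= ?repl_l ?repl_D 1?eq_sym //.
by congr (h x q _); rewrite {2}rs.
Qed.

(** If [x] holds after [u] is put at a coordinate of the trusted arrangement,
    the witness made for this arrangement, coordinate and [u] gives again a
    trusted arrangement.  In the other direction [op_c i x] holds at the
    sequence with [w] inserted, and does not distinguish it from [r], because
    [op_c i x] is a value of [op_s i j] and [repaired] respects substitutions. *)
Lemma repaired_c i x q (r : 'I_n -> point n (U q)) :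
  repaired (op_c i x) r = exists w, repaired x (upd r i w).
Proof.
have [s rs] := rep_ex r; apply/propext; split.
  rewrite (repairedE _ rs) P_c h_c => -[u hu].
  pose r' := upd (rep r) (s i) (wit (rep r) (s i) u).
  have r'rep : rep r' = r'.
    by apply: rep_preferred; right; exists (rep r), (s i), u.
  exists (wit (rep r) (s i) u).
  have -> : upd r i (wit (rep r) (s i) u) = r' \o s.
    apply/funext => k; rewrite /r' /upd /= (inj_eq perm_inj).
    by case: ifP => // _; rewrite [in LHS]rs.
  exists s; rewrite rep_orbit r'rep; split=> //.
  congr (h (P s x) q _): hu; apply/funext => k; rewrite /r' /upd /=.
  by case: ifP.
move=> [w hw]; have {hw} : repaired (op_c i x) (upd r i w).
  have [s' rs'] := rep_ex (upd r i w); move: hw.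
  by rewrite !(repairedE _ rs') P_c; exact: le_c.
have [j [ji _]] := third i i.
rewrite -(s_c i j) !repaired_s; congr (repaired _ _); apply/funext => k /=.
have [->|ki] := eqVneq k i; first by rewrite repl_l /upd (negPf ji).
by rewrite repl_D // /upd (negPf ki).
Qed.

Lemma repaired_hom : is_hom repaired.
Proof.
split; [exact: repaired_add|exact: repaired_neg|].
move=> [i|i j|i j] x; apply: functional_extensionality_dep => q; apply/funext => r.
- exact: repaired_c.
- by rewrite [LHS]repaired_s [RHS]substituteE.
- by rewrite [LHS]repaired_p [RHS]transposeE.
Qed.

(** Every sequence [r] of the given representation is the colouring of the
    preferred sequence of points [base k (r k)], where [h] is trusted. *)
Lemma repaired_inj : injective repaired.
Proof.
move=> x y eqxy; apply: h_ext => q r.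
pose b k := base k (r k).
have repb : rep b = b by apply: rep_preferred; left; exists r.
have b1 : b = rep b \o (1%g : {perm 'I_n}).
  by rewrite repb; apply/funext => k /=; rewrite perm1.
have := congr1 (fun f => f q b) eqxy.
by rewrite /= !(repairedE _ b1) !P1 repb.
Qed.

End Repair.

Theorem theorem1p3 (n : nat) (hn : 3 <= n) (A : algebra (fpa_op n)) :
  RFPA A <->
  (S_Rd_cs_RFPA (Rd_cs A) /\
   forall i j k : 'I_n, i != j -> i != k -> j != k ->
     (forall x y : A, op_p i j (alg_add x y) = alg_add (op_p i j x) (op_p i j y)) /\
     (forall x : A, op_p i j (alg_neg x) = alg_neg (op_p i j x)) /\
     (forall x : A, op_p i j (op_p i j x) = x) /\
     (forall x : A, op_p i j x = op_p j i x) /\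
     (forall x : A, op_p i i x = x) /\
     (forall x : A, op_p i j (op_s j i x) = op_s i j x) /\
     (forall x : A, op_p i j (op_p i k x) = op_p j k (op_p i j x))).
Proof.
split=> [rA|[/S_Rd_cs_RFPA_embedding[I [U [h [h_hom h_inj]]]] eqs]].
  by split; [exact: RFPA_reduct|exact: RFPA_transposition_equations].
have pii i x : op_p i i x = x :> A.
  have [j [ji _]] := third hn i i; have [k [ki kj]] := third hn i j.
  have [ij [ik jk]] : i != j /\ i != k /\ j != k by rewrite ![_ == k]eq_sym eq_sym.
  by have [_ [_ [_ [_ [-> _]]]]] := eqs i j k ij ik jk.
have distinct (i j : 'I_n) : i != j -> exists k, i != k /\ j != k.
  by have [k [ki kj]] := third hn i j; exists k; rewrite ![_ == k]eq_sym.
have pD i j (x y : A) : op_p i j (alg_add x y) = alg_add (op_p i j x) (op_p i j y).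
  have [<-|ij] := eqVneq i j; first by rewrite !pii.
  by have [k [ik jk]] := distinct i j ij; case: (eqs i j k ij ik jk).
have pN i j (x : A) : op_p i j (alg_neg x) = alg_neg (op_p i j x).
  have [<-|ij] := eqVneq i j; first by rewrite !pii.
  by have [k [ik jk]] := distinct i j ij; case: (eqs i j k ij ik jk) => _ [].
have pK i j (x : A) : op_p i j (op_p i j x) = x.
  have [<-|ij] := eqVneq i j; first by rewrite !pii.
  by have [k [ik jk]] := distinct i j ij; case: (eqs i j k ij ik jk) => _ [_ []].
have pC i j (x : A) : op_p i j x = op_p j i x.
  have [<-|ij] := eqVneq i j; first by [].
  by have [k [ik jk]] := distinct i j ij;
    case: (eqs i j k ij ik jk) => _ [_ [_ []]].
have ps i j (x : A) : i != j -> op_p i j (op_s j i x) = op_s i j x.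
  move=> ij; have [k [ik jk]] := distinct i j ij.
  by case: (eqs i j k ij ik jk) => _ [_ [_ [_ [_ []]]]].
have pbraid i j k (x : A) : i != j -> i != k -> j != k ->
    op_p i j (op_p i k x) = op_p j k (op_p i j x).
  by move=> ij ik jk; case: (eqs i j k ij ik jk) => _ [_ [_ [_ [_ [_]]]]].
have [P [P1 Pt PM]] := transposition_action pii pC pK pbraid.
apply/RFPA_embedding; exists I, (fun q => point n (U q)), (repaired h P); split.
  exact: repaired_hom.
exact: repaired_inj.
Qed.
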